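(* Let $\alpha>0$. Any $b_t$-RODE stochastisation of the Landau-Lifshitz equation $\frac{dz}{dt}=z\wedge b-\alpha\,z\wedge(z\wedge b)$, $z\in\mathbb{R}^3$, preserves the double bracket dissipative Hamiltonian structure; that is, for any $\mathbb{R}^3$-valued stochastic process $b_t$ with continuous sample paths, setting $H_{b_t(\omega)}(z)=z\cdot b_t(\omega)$, the equation $$\frac{dz}{dt}=z\wedge b_t(\omega)-\alpha\,z\wedge(z\wedge b_t(\omega))$$ can be written, for every $t$ and almost every $\omega$, as $$\frac{dz}{dt}=X_{H_{b_t(\omega)},\{\cdot,\cdot\}_-}(z)+X_{H_{b_t(\omega)},\{\{\cdot,\cdot\}\}}(z).$$
   Context: $\wedge$ is the cross product in $\mathbb{R}^3$. On smooth functions on $\mathbb{R}^3$ define the Poisson bracket $\{F,G\}_-(z)=-z\cdot(\nabla F(z)\wedge\nabla G(z))$ and the (symmetric) double bracket $\{\{F,G\}\}(z)=\alpha\,[z\wedge\nabla F(z)]\cdot[z\wedge\nabla G(z)]$. For a function $H$, the vector fields $X_{H,\{\cdot,\cdot\}_-}$ and $X_{H,\{\{\cdot,\cdot\}\}}$ are defined by $X_{H,\{\cdot,\cdot\}_-}[F]=\{F,H\}_-$ and $X_{H,\{\{\cdot,\cdot\}\}}[F]=\{\{F,H\}\}$ for all smooth $F$, where $X[F]=\nabla F\cdot X$. A system is a double bracket dissipative Hamiltonian system with Hamiltonian $H$ when it has the form $\dot z=X_{H,\{\cdot,\cdot\}_-}(z)+X_{H,\{\{\cdot,\cdot\}\}}(z)$;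 the deterministic Landau-Lifshitz equation has this form with $H(z)=z\cdot b$. The RODE stochastisation replaces the parameter $b$ by the process $b_t(\omega)$, pathwise. *)

(* Defs.v *)
From HB Require Import structures.
From mathcomp Require Import all_boot all_order all_algebra.
From mathcomp Require Import all_classical all_reals all_analysis.

Set Implicit Arguments.
Unset Strict Implicit.
Unset Printing Implicit Defensive.

Import Order.TTheory GRing.Theory Num.Theory.
Import numFieldNormedType.Exports.

Local Open Scope classical_set_scope.
Local Open Scope ring_scope.

Definition dotv (R : realType) (u v : 'rV[R]_3) : R :=
  \sum_(i < 3) u 0 i * v 0 i.

(* The indices i + 1 and i + 2 are taken in the ring 'I_3, i.e. modulo 3. *)
Definition crossv (R : realType) (u v : 'rV[R]_3) : 'rV[R]_3 :=
  \row_(i < 3) (u 0 (i + 1) * v 0 (i + 2%:R) - u 0 (i + 2%:R) * v 0 (i + 1)).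

Definition partial (R : realType) (i : 'I_3) (F : 'rV[R]_3 -> R)
    : 'rV[R]_3 -> R :=
  fun z => 'D_(delta_mx 0 i) F z.

(* C^oo: every iterated partial derivative (the case s = [::] being F itself)
   is differentiable everywhere, hence also continuous. *)
Definition smooth (R : realType) (F : 'rV[R]_3 -> R) : Prop :=
  forall (s : seq 'I_3) (z : 'rV[R]_3),
    differentiable (foldr (@partial R) F s) z.

Definition grad (R : realType) (F : 'rV[R]_3 -> R) (z : 'rV[R]_3)
    : 'rV[R]_3 :=
  \row_(i < 3) partial i F z.

(* X[F] *)
Definition vf_apply (R : realType) (X : 'rV[R]_3 -> 'rV[R]_3)
    (F : 'rV[R]_3 -> R) : 'rV[R]_3 -> R :=
  fun z => dotv (grad F z) (X z).

Definition bracket (R : realType) : Type :=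
  ('rV[R]_3 -> R) -> ('rV[R]_3 -> R) -> 'rV[R]_3 -> R.

Definition poisson_minus (R : realType) : bracket R :=
  fun F G z => - dotv z (crossv (grad F z) (grad G z)).

Definition double_bracket (R : realType) (alpha : R) : bracket R :=
  fun F G z => alpha * dotv (crossv z (grad F z)) (crossv z (grad G z)).

Definition is_bracket_vf (R : realType) (br : bracket R) (H : 'rV[R]_3 -> R)
    (X : 'rV[R]_3 -> 'rV[R]_3) : Prop :=
  forall F : 'rV[R]_3 -> R, smooth F -> vf_apply X F = br F H.

(* The vector field X_{H,br}. It is selected by classical choice, so it is
   meaningful only when [is_bracket_vf br H] has exactly one solution, which
   is part of [double_bracket_dissipative]. *)
Definition bracket_vf (R : realType) (br : bracket R) (H : 'rV[R]_3 -> R)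
    : 'rV[R]_3 -> 'rV[R]_3 :=
  get [set X | is_bracket_vf br H X].

(* An equation dz/dt = f(z) is represented by its right-hand side f. *)
Definition double_bracket_dissipative (R : realType) (alpha : R)
    (H : 'rV[R]_3 -> R) (f : 'rV[R]_3 -> 'rV[R]_3) : Prop :=
  [/\ smooth H,
      exists! X, is_bracket_vf (@poisson_minus R) H X,
      exists! X, is_bracket_vf (double_bracket alpha) H X &
      forall z, f z = bracket_vf (@poisson_minus R) H z
                      + bracket_vf (double_bracket alpha) H z].

Definition landau_lifshitz (R : realType) (alpha : R) (b z : 'rV[R]_3)
    : 'rV[R]_3 :=
  crossv z b - alpha *: crossv z (crossv z b).

Definition LL_hamiltonian (R : realType) (b z : 'rV[R]_3) : R := dotv z b.

(* The right-hand side, at time t and for the outcome w, of the random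
   equation obtained from dz/dt = f b z by replacing the parameter b by the
   process b_t(w). *)
Definition rode_stochastisation (R : realType) (T : Type)
    (f : 'rV[R]_3 -> 'rV[R]_3 -> 'rV[R]_3) (b : R -> T -> 'rV[R]_3)
    (t : R) (w : T) : 'rV[R]_3 -> 'rV[R]_3 :=
  f (b t w).

(* An R^3-valued process indexed by the time interval I, with almost surely
   continuous sample paths. Measurability is stated componentwise, which is
   Borel measurability in R^3. *)
Definition continuous_process (d : measure_display) (T : measurableType d)
    (R : realType) (P : probability T R) (I : interval R)
    (b : R -> T -> 'rV[R]_3) : Prop :=
  (forall t, t \in I ->
     forall i : 'I_3, measurable_fun [set: T] (fun w => b t w 0 i)) /\
  {ae P, forall w, {within [set` I], continuous (fun t => b t w)}}.

(* Main.v *)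
Require Import Defs.
From HB Require Import structures.
From mathcomp Require Import all_boot all_order all_algebra.
From mathcomp Require Import all_classical all_reals all_analysis.
From mathcomp Require Import ring.

Import Order.TTheory GRing.Theory Num.Theory.
Import numFieldNormedType.Exports.

Local Open Scope classical_set_scope.
Local Open Scope ring_scope.

(** The differential of the linear Hamiltonian z . b is b at every point, so
    moving grad F to the front of the two brackets by the cyclic symmetry of
    the triple product gives
      -z . (grad F /\ b) = grad F . (z /\ b),
      alpha (z /\ grad F) . (z /\ b) = - alpha grad F . (z /\ (z /\ b))
    for every F. Thus z /\ b and - alpha z /\ (z /\ b), the two terms of the
    Landau-Lifshitz equation, satisfy the equations that define X_{H,br}
    for the two brackets ([poisson_minus_vf], [double_bracket_vf]).

    A vector field is determined by its action on smooth functions, because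
    the coordinate functions are smooth and their gradients form a basis.
    Hence each bracket has exactly one vector field, and the field selected by
    choice is the one found above ([bracket_vf_unique]).

    All of this holds for each fixed vector b. The argument therefore applies
    separately to each value b_t(w): replacing the constant parameter by a
    process pathwise does not affect the structure. *)

Lemma LL_hamiltonian_is_linear (R : realType) (c : 'rV[R]_3) :
  linear (LL_hamiltonian c : 'rV[R]_3 -> R^o).
Proof.
move=> k x y; rewrite /LL_hamiltonian /dotv scaler_sumr -big_split /=.
by apply: eq_bigr => i _; rewrite !mxE mulrDl -mulrA.
Qed.

HB.instance Definition _ (R : realType) (c : 'rV[R]_3) :=
  GRing.isLinear.Build R 'rV[R]_3 R^o _ (LL_hamiltonian c)
    (@LL_hamiltonian_is_linear R c).

Lemma continuous_LL_hamiltonian (R : realType) (c : 'rV[R]_3) :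
  continuous (LL_hamiltonian c : 'rV[R]_3 -> R^o).
Proof.
apply: (continuous_big (op := +%R)) => [|i _]; first exact: add_continuous.
by move=> z; apply: continuousM;
  [exact: coord_continuous | exact: cst_continuous].
Qed.

Lemma differentiable_LL_hamiltonian (R : realType) (c z : 'rV[R]_3) :
  differentiable (LL_hamiltonian c) z.
Proof. exact/linear_differentiable/continuous_LL_hamiltonian. Qed.

Lemma partial_LL_hamiltonian (R : realType) (c : 'rV[R]_3) (i : 'I_3) :
  partial i (LL_hamiltonian c) = cst (c 0 i).
Proof.
apply/funext => z.
rewrite /partial deriveE; last exact: differentiable_LL_hamiltonian.
rewrite diff_lin; last exact: continuous_LL_hamiltonian.
rewrite /= /LL_hamiltonian /dotv (bigD1 i) //= big1 ?addr0 => [|j ji].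
  by rewrite !mxE !eqxx mul1r.
by rewrite !mxE (negbTE ji) andbF mul0r.
Qed.

Lemma grad_LL_hamiltonian (R : realType) (c z : 'rV[R]_3) :
  grad (LL_hamiltonian c) z = c.
Proof. by apply/rowP => i; rewrite mxE partial_LL_hamiltonian. Qed.

(** The first partial derivatives are constants, so every longer iterate is a
    constant as well. *)
Lemma smooth_LL_hamiltonian (R : realType) (c : 'rV[R]_3) :
  smooth (LL_hamiltonian c).
Proof.
move=> s z; case: s => [|i s]; first exact: differentiable_LL_hamiltonian.
have [k ->] : exists k : R,
    foldr (@partial R) (LL_hamiltonian c) (i :: s) = cst k.
  elim: s i => [|j s IHs] i /=.
    by exists (c 0 i); rewrite partial_LL_hamiltonian.
  have [k /= ->] := IHs j.
  by exists 0; apply/funext => y; rewrite /partial derive_cst.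
exact: differentiable_cst.
Qed.

(** The coordinate functions z |-> z . e_i are smooth with gradient e_i, so
    they read off the components of a field. *)
Lemma vf_apply_smooth_inj (R : realType) (X Y : 'rV[R]_3 -> 'rV[R]_3) :
  (forall F, smooth F -> vf_apply X F = vf_apply Y F) -> X = Y.
Proof.
move=> XY; apply/funext => z; apply/rowP => i.
have /(congr1 (@^~ z)) := XY _ (smooth_LL_hamiltonian R (delta_mx 0 i)).
rewrite /vf_apply grad_LL_hamiltonian.
suff dot_delta (v : 'rV[R]_3) : dotv (delta_mx 0 i) v = v 0 i.
  by rewrite !dot_delta.
rewrite /dotv (bigD1 i) //= big1 ?addr0 => [|j ji].
  by rewrite !mxE !eqxx mul1r.
by rewrite !mxE (negbTE ji) andbF mul0r.
Qed.

Lemma is_bracket_vf_unique (R : realType) (br : bracket R)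
    (H : 'rV[R]_3 -> R) (X : 'rV[R]_3 -> 'rV[R]_3) :
  is_bracket_vf br H X -> unique (is_bracket_vf br H) X.
Proof.
move=> HX; split=> // Y HY; apply: vf_apply_smooth_inj => F sF.
by rewrite HX ?HY.
Qed.

(** Uniqueness turns the choice in [bracket_vf] into a definite description. *)
Lemma bracket_vf_unique (R : realType) (br : bracket R)
    (H : 'rV[R]_3 -> R) (X : 'rV[R]_3 -> 'rV[R]_3) :
  is_bracket_vf br H X -> bracket_vf br H = X.
Proof.
move=> HX; have [_ uX] := is_bracket_vf_unique R br H X HX.
apply/esym/uX.
exact: (@getPex _ [set Y | is_bracket_vf br H Y] (ex_intro _ X HX)).
Qed.

Lemma dotvE (R : realType) (u v : 'rV[R]_3) :
  dotv u v = u 0 0 * v 0 0 + u 0 1 * v 0 1 + u 0 2%:R * v 0 2%:R.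
Proof.
rewrite /dotv !big_ord_recl big_ord0 addr0 addrA.
by congr (_ + _ * _ + _ * _); congr (_ 0 _); apply/val_inj.
Qed.

Lemma crossvE (R : realType) (u v : 'rV[R]_3) :
  ((crossv u v 0 0 = u 0 1 * v 0 2%:R - u 0 2%:R * v 0 1) *
   (crossv u v 0 1 = u 0 2%:R * v 0 0 - u 0 0 * v 0 2%:R) *
   (crossv u v 0 2%:R = u 0 0 * v 0 1 - u 0 1 * v 0 0))%type.
Proof.
by do !split; rewrite mxE; congr (_ * _ - _ * _); congr (_ 0 _); apply/val_inj.
Qed.

Lemma dotv_crossv_cycle (R : realType) (u v w : 'rV[R]_3) :
  dotv u (crossv v w) = dotv v (crossv w u).
Proof. by rewrite !dotvE !crossvE; ring. Qed.

Lemma dotvC (R : realType) (u v : 'rV[R]_3) : dotv u v = dotv v u.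
Proof. by rewrite !dotvE; ring. Qed.

Lemma crossvC (R : realType) (u v : 'rV[R]_3) : crossv u v = - crossv v u.
Proof. by apply/rowP => i; rewrite !mxE; ring. Qed.

Lemma dotvNr (R : realType) (u v : 'rV[R]_3) : dotv u (- v) = - dotv u v.
Proof. by rewrite !dotvE !mxE; ring. Qed.

Lemma dotvZr (R : realType) (k : R) (u v : 'rV[R]_3) :
  dotv u (k *: v) = k * dotv u v.
Proof. by rewrite !dotvE !mxE; ring. Qed.

Lemma poisson_minus_vf (R : realType) (c : 'rV[R]_3) :
  is_bracket_vf (@poisson_minus R) (LL_hamiltonian c) (fun z => crossv z c).
Proof.
move=> F _; apply/funext => z.
rewrite /vf_apply /poisson_minus grad_LL_hamiltonian.
by rewrite dotv_crossv_cycle crossvC dotvNr.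
Qed.

Lemma double_bracket_vf (R : realType) (alpha : R) (c : 'rV[R]_3) :
  is_bracket_vf (double_bracket alpha) (LL_hamiltonian c)
    (fun z => - (alpha *: crossv z (crossv z c))).
Proof.
move=> F _; apply/funext => z.
rewrite /vf_apply /double_bracket grad_LL_hamiltonian dotvNr dotvZr -mulrN.
by rewrite -dotvNr -crossvC dotv_crossv_cycle dotvC.
Qed.

Lemma landau_lifshitz_double_bracket_dissipative (R : realType) (alpha : R)
    (c : 'rV[R]_3) :
  double_bracket_dissipative alpha (LL_hamiltonian c)
    (landau_lifshitz alpha c).
Proof.
have Hp := poisson_minus_vf R c; have Hd := double_bracket_vf R alpha c.
split.
- exact: smooth_LL_hamiltonian.
- by eexists; exact: is_bracket_vf_unique Hp.
- by eexists; exact: is_bracket_vf_unique Hd.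
- move=> z; rewrite (bracket_vf_unique _ _ _ _ Hp).
  by rewrite (bracket_vf_unique _ _ _ _ Hd).
Qed.

Theorem lemma7p16 (R : realType) (alpha : R) (alpha_gt0 : 0 < alpha)
    (d : measure_display) (T : measurableType d) (P : probability T R)
    (I : interval R) (b : R -> T -> 'rV[R]_3)
    (b_process : continuous_process P I b) :
  forall t : R, t \in I ->
    {ae P, forall w : T,
      double_bracket_dissipative alpha (LL_hamiltonian (b t w))
        (rode_stochastisation (landau_lifshitz alpha) b t w)}.
Proof.
move=> t _; apply: aeW => w.
exact: landau_lifshitz_double_bracket_dissipative.
Qed.
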